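(* If $\mathsf{D}$ is a symmetric monoidal category, then the category of commutative comonoids in $\mathsf{D}$ with counit-preserving morphisms is a Markov category (with the usual tensor product of commutative comonoids, the symmetry inherited from $\mathsf{D}$, and with $\mathsf{copy}_X:=\mu_X$ and $\mathsf{del}_X:=e_X$ on a comonoid $(X,\mu_X,e_X)$).
   Context: A Markov category is a symmetric monoidal category $(\mathsf{C},\otimes,I)$ with symmetry $\mathsf{swap}_{X,Y}:X\otimes Y\to Y\otimes X$, in which every object $X$ is equipped with morphisms $\mathsf{copy}_X:X\to X\otimes X$ and $\mathsf{del}_X:X\to I$ forming a commutative comonoid (coassociative, counital, cocommutative, with respect to the associators, unitors and symmetry), such that: (i) $\mathsf{del}_{X\otimes Y}$ is $\mathsf{del}_X\otimes\mathsf{del}_Y$ followed by $I\otimes I\cong I$; (ii) $\mathsf{copy}_{X\otimes Y}$ is $\mathsf{copy}_X\otimes\mathsf{copy}_Y$ followed by the canonical isomorphism $(X\otimes X)\otimes(Y\otimes Y)\cong(X\otimes Y)\otimes(X\otimes Y)$ built from associators and the symmetry on the two middle factors; (iii) $\mathsf{del}_Y\circ f=\mathsf{del}_X$ for every $f:X\to Y$. For a symmetric monoidal category $\mathsf{D}$, the category of commutative comonoids in $\mathsf{D}$ with counit-preserving morphisms has as objects the triples $(X,\mu_X,e_X)$, where $\mu_X:X\to X\otimes X$ and $e_X:X\to I$ form a commutative comonoid in $\mathsf{D}$, and as morphisms $(X,\mu_X,e_X)\to(Y,\mu_Y,e_Y)$ the morphisms $f:X\to Y$ of $\mathsf{D}$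 with $e_Y\circ f=e_X$ (not required to preserve the comultiplications). The usual tensor product of commutative comonoids $(X,\mu_X,e_X)$ and $(Y,\mu_Y,e_Y)$ has underlying object $X\otimes Y$, comultiplication $\mu_X\otimes\mu_Y$ followed by swapping the two middle factors, and counit $e_X\otimes e_Y$ followed by $I\otimes I\cong I$. *)

(* Defs.v *)
From Stdlib Require Import ProofIrrelevance.

Set Implicit Arguments.
Unset Strict Implicit.
Unset Printing Implicit Defensive.

Declare Scope cat_scope.
Delimit Scope cat_scope with cat.
Open Scope cat_scope.

Record category := Category {
  ob :> Type;
  hom : ob -> ob -> Type;
  idm : forall X, hom X X;
  comp : forall X Y Z, hom Y Z -> hom X Y -> hom X Z;
  comp_idl : forall X Y (f : hom X Y), comp (idm Y) f = f;
  comp_idr : forall X Y (f : hom X Y), comp f (idm X) = f;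
  comp_assoc : forall W X Y Z (h : hom Y Z) (g : hom X Y) (f : hom W X),
    comp h (comp g f) = comp (comp h g) f
}.

Arguments hom {c} X Y.
Arguments idm {c} X.
Arguments comp {c X Y Z} g f.

Notation "g ∘ f" := (comp g f) (at level 40, left associativity) : cat_scope.

Definition inverse_pair (C : category) (X Y : C) (f : hom X Y) (g : hom Y X) :
  Prop := g ∘ f = idm X /\ f ∘ g = idm Y.

(** The structure of a symmetric monoidal category is separated from its laws,
    so that "this structure is symmetric monoidal" is a proposition. *)
Record sm_data := SMData {
  sm_cat :> category;
  tens : sm_cat -> sm_cat -> sm_cat;
  tensm : forall X X' Y Y' : sm_cat,
    hom X X' -> hom Y Y' -> hom (tens X Y) (tens X' Y');
  unit_ob : sm_cat;
  assoc : forall X Y Z, hom (tens (tens X Y) Z) (tens X (tens Y Z));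
  assoc_inv : forall X Y Z, hom (tens X (tens Y Z)) (tens (tens X Y) Z);
  lunit : forall X, hom (tens unit_ob X) X;
  lunit_inv : forall X, hom X (tens unit_ob X);
  runit : forall X, hom (tens X unit_ob) X;
  runit_inv : forall X, hom X (tens X unit_ob);
  swap : forall X Y, hom (tens X Y) (tens Y X)
}.

Arguments tens {s} X Y.
Arguments tensm {s X X' Y Y'} f g.
Arguments unit_ob {s}.
Arguments assoc {s} X Y Z.
Arguments assoc_inv {s} X Y Z.
Arguments lunit {s} X.
Arguments lunit_inv {s} X.
Arguments runit {s} X.
Arguments runit_inv {s} X.
Arguments swap {s} X Y.

Notation "X ⊗ Y" := (tens X Y) (at level 35, right associativity) : cat_scope.
Notation "f ⊠ g" := (tensm f g) (at level 35, right associativity) : cat_scope.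

Record is_symmetric_monoidal (M : sm_data) : Prop := IsSymmetricMonoidal {
  tensm_id : forall X Y : M, idm X ⊠ idm Y = idm (X ⊗ Y);
  tensm_comp : forall (X X' X'' Y Y' Y'' : M)
      (f' : hom X' X'') (f : hom X X') (g' : hom Y' Y'') (g : hom Y Y'),
    (f' ∘ f) ⊠ (g' ∘ g) = (f' ⊠ g') ∘ (f ⊠ g);

  assoc_iso : forall X Y Z : M, inverse_pair (assoc X Y Z) (assoc_inv X Y Z);
  lunit_iso : forall X : M, inverse_pair (lunit X) (lunit_inv X);
  runit_iso : forall X : M, inverse_pair (runit X) (runit_inv X);

  assoc_natural : forall (X X' Y Y' Z Z' : M)
      (f : hom X X') (g : hom Y Y') (h : hom Z Z'),
    assoc X' Y' Z' ∘ ((f ⊠ g) ⊠ h) = (f ⊠ (g ⊠ h)) ∘ assoc X Y Z;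
  lunit_natural : forall (X Y : M) (f : hom X Y),
    lunit Y ∘ (idm unit_ob ⊠ f) = f ∘ lunit X;
  runit_natural : forall (X Y : M) (f : hom X Y),
    runit Y ∘ (f ⊠ idm unit_ob) = f ∘ runit X;
  swap_natural : forall (X X' Y Y' : M) (f : hom X X') (g : hom Y Y'),
    swap X' Y' ∘ (f ⊠ g) = (g ⊠ f) ∘ swap X Y;

  pentagon : forall W X Y Z : M,
    assoc W X (Y ⊗ Z) ∘ assoc (W ⊗ X) Y Z
    = (idm W ⊠ assoc X Y Z) ∘ assoc W (X ⊗ Y) Z ∘ (assoc W X Y ⊠ idm Z);
  triangle : forall X Y : M,
    (idm X ⊠ lunit Y) ∘ assoc X unit_ob Y = runit X ⊠ idm Y;
  hexagon : forall X Y Z : M,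
    assoc Y Z X ∘ swap X (Y ⊗ Z) ∘ assoc X Y Z
    = (idm Y ⊠ swap X Z) ∘ assoc Y X Z ∘ (swap X Y ⊠ idm Z);
  swap_swap : forall X Y : M, swap Y X ∘ swap X Y = idm (X ⊗ Y)
}.

Record symmetric_monoidal_category := SymmetricMonoidalCategory {
  smc_data :> sm_data;
  smc_laws : is_symmetric_monoidal smc_data
}.

Record is_commutative_comonoid (M : sm_data) (X : M)
    (mu : hom X (X ⊗ X)) (e : hom X unit_ob) : Prop := IsCommutativeComonoid {
  coassociative : assoc X X X ∘ (mu ⊠ idm X) ∘ mu = (idm X ⊠ mu) ∘ mu;
  counital_l : lunit X ∘ (e ⊠ idm X) ∘ mu = idm X;
  counital_r : runit X ∘ (idm X ⊠ e) ∘ mu = idm X;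
  cocommutative : swap X X ∘ mu = mu
}.

Definition swap_middle (M : sm_data) (W X Y Z : M) :
    hom ((W ⊗ X) ⊗ (Y ⊗ Z)) ((W ⊗ Y) ⊗ (X ⊗ Z)) :=
  assoc_inv W Y (X ⊗ Z)
  ∘ (idm W ⊠ (assoc Y X Z ∘ (swap X Y ⊠ idm Z) ∘ assoc_inv X Y Z))
  ∘ assoc W X (Y ⊗ Z).

Record markov_data := MarkovData {
  markov_sm :> sm_data;
  copy : forall X : markov_sm, hom X (X ⊗ X);
  del : forall X : markov_sm, hom X unit_ob
}.

Arguments copy {m} X.
Arguments del {m} X.

Record is_markov_category (M : markov_data) : Prop := IsMarkovCategory {
  markov_symmetric_monoidal : is_symmetric_monoidal M;
  markov_comonoid : forall X : M, is_commutative_comonoid (copy X) (del X);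
  del_tens : forall X Y : M, del (X ⊗ Y) = lunit unit_ob ∘ (del X ⊠ del Y);
  copy_tens : forall X Y : M,
    copy (X ⊗ Y) = swap_middle X X Y Y ∘ (copy X ⊠ copy Y);
  del_natural : forall (X Y : M) (f : hom X Y), del Y ∘ f = del X
}.

Record comonoid_data (M : sm_data) := ComonoidData {
  carrier :> ob M;
  comult : hom carrier (carrier ⊗ carrier);
  counit : hom carrier unit_ob
}.

Arguments comult {M} c.
Arguments counit {M} c.

Record comonoid (M : sm_data) := Comonoid {
  comonoid_triple :> comonoid_data M;
  comonoid_laws :
    is_commutative_comonoid (comult comonoid_triple) (counit comonoid_triple)
}.

Definition counit_preserving (M : sm_data) (X Y : comonoid_data M)
    (f : hom (carrier X) (carrier Y)) : Prop :=
  counit Y ∘ f = counit X.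

Definition comonoid_hom (M : sm_data) (X Y : comonoid M) : Type :=
  {f : hom (carrier X) (carrier Y) | counit_preserving f}.

Definition comonoid_idm (M : sm_data) (X : comonoid M) : comonoid_hom X X :=
  exist _ (idm (carrier X)) (comp_idr (counit X)).

Lemma counit_preserving_comp (M : sm_data) (X Y Z : comonoid_data M)
    (g : hom (carrier Y) (carrier Z)) (f : hom (carrier X) (carrier Y)) :
  counit_preserving g -> counit_preserving f -> counit_preserving (g ∘ f).
Proof.
  unfold counit_preserving; intros Hg Hf.
  now rewrite comp_assoc, Hg.
Qed.

Definition comonoid_comp (M : sm_data) (X Y Z : comonoid M)
    (g : comonoid_hom Y Z) (f : comonoid_hom X Y) : comonoid_hom X Z :=
  exist _ (proj1_sig g ∘ proj1_sig f)
    (counit_preserving_comp (proj2_sig g) (proj2_sig f)).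

Lemma comonoid_hom_eq (M : sm_data) (X Y : comonoid M) (f g : comonoid_hom X Y) :
  proj1_sig f = proj1_sig g -> f = g.
Proof.
  destruct f, g; apply subset_eq_compat.
Qed.

Definition comonoid_category (M : sm_data) : category.
Proof.
  refine (@Category (comonoid M) (@comonoid_hom M) (@comonoid_idm M)
            (@comonoid_comp M) _ _ _);
    intros; apply comonoid_hom_eq; simpl.
  - apply comp_idl.
  - apply comp_idr.
  - apply comp_assoc.
Defined.

Definition tens_comonoid_data (M : sm_data) (X Y : comonoid_data M) :
    comonoid_data M :=
  {| carrier := carrier X ⊗ carrier Y;
     comult := swap_middle (carrier X) (carrier X) (carrier Y) (carrier Y)
               ∘ (comult X ⊠ comult Y);
     counit := lunit unit_ob ∘ (counit X ⊠ counit Y) |}.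

Definition unit_comonoid_data (M : sm_data) : comonoid_data M :=
  {| carrier := unit_ob;
     comult := lunit_inv unit_ob;
     counit := idm unit_ob |}.

Arguments unit_comonoid_data {M}.

(** Everything that has to hold for the tensor product, the structure
    isomorphisms, the comultiplications and the counits of [M] to lie in
    [comonoid_category M].  These are not assumptions: the main statement
    asserts them together with the Markov category laws. *)
Record comonoids_closed (M : sm_data) : Prop := ComonoidsClosed {
  closed_tens : forall X Y : comonoid M,
    is_commutative_comonoid (comult (tens_comonoid_data X Y))
                            (counit (tens_comonoid_data X Y));
  closed_unit :
    is_commutative_comonoid (comult (@unit_comonoid_data M))
                            (counit (@unit_comonoid_data M));
  closed_tensm : forall (X X' Y Y' : comonoid M)
      (f : comonoid_hom X X') (g : comonoid_hom Y Y'),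
    @counit_preserving M (tens_comonoid_data X Y) (tens_comonoid_data X' Y')
      (proj1_sig f ⊠ proj1_sig g);
  closed_assoc : forall X Y Z : comonoid M,
    @counit_preserving M
      (tens_comonoid_data (tens_comonoid_data X Y) Z)
      (tens_comonoid_data X (tens_comonoid_data Y Z))
      (assoc (carrier X) (carrier Y) (carrier Z));
  closed_assoc_inv : forall X Y Z : comonoid M,
    @counit_preserving M
      (tens_comonoid_data X (tens_comonoid_data Y Z))
      (tens_comonoid_data (tens_comonoid_data X Y) Z)
      (assoc_inv (carrier X) (carrier Y) (carrier Z));
  closed_lunit : forall X : comonoid M,
    @counit_preserving M (tens_comonoid_data unit_comonoid_data X) X
      (lunit (carrier X));
  closed_lunit_inv : forall X : comonoid M,
    @counit_preserving M X (tens_comonoid_data unit_comonoid_data X)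
      (lunit_inv (carrier X));
  closed_runit : forall X : comonoid M,
    @counit_preserving M (tens_comonoid_data X unit_comonoid_data) X
      (runit (carrier X));
  closed_runit_inv : forall X : comonoid M,
    @counit_preserving M X (tens_comonoid_data X unit_comonoid_data)
      (runit_inv (carrier X));
  closed_swap : forall X Y : comonoid M,
    @counit_preserving M (tens_comonoid_data X Y) (tens_comonoid_data Y X)
      (swap (carrier X) (carrier Y));
  closed_copy : forall X : comonoid M,
    @counit_preserving M X (tens_comonoid_data X X) (comult X);
  closed_del : forall X : comonoid M,
    @counit_preserving M X unit_comonoid_data (counit X)
}.

Definition comonoid_sm (M : sm_data) (H : comonoids_closed M) : sm_data :=
  {| sm_cat := comonoid_category M;
     tens := fun X Y : comonoid M => Comonoid (closed_tens H X Y);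
     tensm := fun (X X' Y Y' : comonoid M)
                (f : comonoid_hom X X') (g : comonoid_hom Y Y') =>
       exist _ (proj1_sig f ⊠ proj1_sig g) (closed_tensm H f g);
     unit_ob := Comonoid (closed_unit H);
     assoc := fun X Y Z : comonoid M => exist _ _ (closed_assoc H X Y Z);
     assoc_inv := fun X Y Z : comonoid M => exist _ _ (closed_assoc_inv H X Y Z);
     lunit := fun X : comonoid M => exist _ _ (closed_lunit H X);
     lunit_inv := fun X : comonoid M => exist _ _ (closed_lunit_inv H X);
     runit := fun X : comonoid M => exist _ _ (closed_runit H X);
     runit_inv := fun X : comonoid M => exist _ _ (closed_runit_inv H X);
     swap := fun X Y : comonoid M => exist _ _ (closed_swap H X Y) |}.

Definition comonoid_markov (M : sm_data) (H : comonoids_closed M) : markov_data :=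
  {| markov_sm := comonoid_sm H;
     copy := fun X : comonoid M => exist _ (comult X) (closed_copy H X);
     del := fun X : comonoid M => exist _ (counit X) (closed_del H X) |}.

(* Main.v *)
Require Import Defs.
From Stdlib Require Import ssreflect.

(** The middle interchange (W ⊗ X) ⊗ (Y ⊗ Z) -> (W ⊗ Y) ⊗ (X ⊗ Z) is natural and
    compatible with associators, unitors and symmetries; the axioms of the tensor
    product of two comonoids follow by applying this compatibility to the axioms
    of the factors.  For the coherence, work with the maps
    X ⊗ (Y ⊗ Z) -> Y ⊗ (X ⊗ Z), that is, the symmetry acting in front of a
    spectator Z: after rebracketing everything to the right, the interchange is
    such a map whiskered by W, and the hexagons say how it decomposes when X or
    Y is a tensor product. *)

Set Implicit Arguments.
Unset Strict Implicit.
Unset Printing Implicit Defensive.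

(** * Rewriting up to associativity, and cancellation of split maps *)

Lemma comp_eq2 (C : category) (W X Y Z : C) (g : hom X Y) (f : hom W X)
    (r : hom W Y) :
  g ∘ f = r -> forall h : hom Y Z, h ∘ g ∘ f = h ∘ r.
Proof. by move=> <- h; rewrite comp_assoc. Qed.

Lemma comp_eq3 (C : category) (V W X Y Z : C) (g : hom X Y) (f : hom W X)
    (e : hom V W) (r : hom V Y) :
  g ∘ f ∘ e = r -> forall h : hom Y Z, h ∘ g ∘ f ∘ e = h ∘ r.
Proof. by move=> <- h; rewrite !comp_assoc. Qed.

(* Rewrites modulo associativity of composition, keeping composites nested to
   the left. *)
Ltac crw E :=
  rewrite ?comp_assoc;
  first [rewrite E | rewrite (comp_eq2 E) | rewrite (comp_eq3 E)];
  rewrite ?comp_assoc ?comp_idl ?comp_idr.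

Lemma split_epi_cancel (C : category) (X Y Z : C) (e : hom X Y) (s : hom Y X)
    (f g : hom Y Z) :
  e ∘ s = idm Y -> f ∘ e = g ∘ e -> f = g.
Proof.
  move=> es fe; rewrite -(comp_idr f) -(comp_idr g) -es.
  by rewrite !comp_assoc fe.
Qed.

Lemma split_mono_cancel (C : category) (X Y Z : C) (m : hom Y Z) (r : hom Z Y)
    (f g : hom X Y) :
  r ∘ m = idm Y -> m ∘ f = m ∘ g -> f = g.
Proof.
  move=> rm mf; rewrite -(comp_idl f) -(comp_idl g) -rm.
  by rewrite -!comp_assoc mf.
Qed.

Section SymmetricMonoidal.

Variable M : sm_data.
Hypothesis HM : is_symmetric_monoidal M.

Implicit Types V W X Y Z : M.

(** * Whiskering and cancellation of associators *)

Lemma whisker_l_comp W X Y Z (g : hom Y Z) (f : hom X Y) :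
  (idm W ⊠ g) ∘ (idm W ⊠ f) = idm W ⊠ (g ∘ f).
Proof. by rewrite -(tensm_comp HM) comp_idl. Qed.

Lemma whisker_r_comp W X Y Z (g : hom Y Z) (f : hom X Y) :
  (g ⊠ idm W) ∘ (f ⊠ idm W) = (g ∘ f) ⊠ idm W.
Proof. by rewrite -(tensm_comp HM) comp_idl. Qed.

Lemma tensm_split_l X X' Y Y' (f : hom X X') (g : hom Y Y') :
  (f ⊠ idm Y') ∘ (idm X ⊠ g) = f ⊠ g.
Proof. by rewrite -(tensm_comp HM) comp_idl comp_idr. Qed.

Lemma tensm_split_r X X' Y Y' (f : hom X X') (g : hom Y Y') :
  (idm X' ⊠ g) ∘ (f ⊠ idm Y) = f ⊠ g.
Proof. by rewrite -(tensm_comp HM) comp_idl comp_idr. Qed.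

Lemma assoc_invK X Y Z : assoc X Y Z ∘ assoc_inv X Y Z = idm _.
Proof. exact: proj2 (assoc_iso HM X Y Z). Qed.

Lemma assocK X Y Z : assoc_inv X Y Z ∘ assoc X Y Z = idm _.
Proof. exact: proj1 (assoc_iso HM X Y Z). Qed.

Lemma lunitK X : lunit_inv X ∘ lunit X = idm _.
Proof. exact: proj1 (lunit_iso HM X). Qed.

Lemma lunit_invK X : lunit X ∘ lunit_inv X = idm _.
Proof. exact: proj2 (lunit_iso HM X). Qed.

Lemma runit_invK X : runit X ∘ runit_inv X = idm _.
Proof. exact: proj2 (runit_iso HM X). Qed.

Lemma assoc_epi X Y Z W (f g : hom (X ⊗ (Y ⊗ Z)) W) :
  f ∘ assoc X Y Z = g ∘ assoc X Y Z -> f = g.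
Proof. exact: split_epi_cancel (assoc_invK X Y Z). Qed.

Lemma assoc_whisker_epi V X Y Z W (f g : hom ((X ⊗ (Y ⊗ Z)) ⊗ V) W) :
  f ∘ (assoc X Y Z ⊠ idm V) = g ∘ (assoc X Y Z ⊠ idm V) -> f = g.
Proof.
  apply: (@split_epi_cancel _ _ _ _ _ (assoc_inv X Y Z ⊠ idm V)).
  by rewrite whisker_r_comp assoc_invK (tensm_id HM).
Qed.

Lemma assoc_mono X Y Z W (f g : hom W ((X ⊗ Y) ⊗ Z)) :
  assoc X Y Z ∘ f = assoc X Y Z ∘ g -> f = g.
Proof. exact: split_mono_cancel (assocK X Y Z). Qed.

(** * Coherence of the unitors *)

Lemma whisker_unit_l_inj X Y (f g : hom X Y) :
  idm unit_ob ⊠ f = idm unit_ob ⊠ g -> f = g.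
Proof.
  move=> fg; apply: (split_epi_cancel (lunit_invK X)).
  by rewrite -!(lunit_natural HM) fg.
Qed.

Lemma whisker_unit_r_inj X Y (f g : hom X Y) :
  f ⊠ idm unit_ob = g ⊠ idm unit_ob -> f = g.
Proof.
  move=> fg; apply: (split_epi_cancel (runit_invK X)).
  by rewrite -!(runit_natural HM) fg.
Qed.

(* Kelly's argument: after whiskering by the unit on the left, the pentagon and
   the triangle apply. *)
Lemma lunit_tens X Y :
  lunit (X ⊗ Y) ∘ assoc unit_ob X Y = lunit X ⊠ idm Y.
Proof.
  apply: whisker_unit_l_inj.
  apply: assoc_epi.
  apply: assoc_whisker_epi.
  rewrite -whisker_l_comp -(assoc_natural HM).
  crw (eq_sym (pentagon HM unit_ob unit_ob X Y)).
  rewrite (triangle HM) -(tensm_id HM) -(assoc_natural HM).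
  by rewrite -!comp_assoc whisker_r_comp (triangle HM).
Qed.

(** Naturality of [lunit] at the morphism [lunit X], with the invertible [lunit X] cancelled. *)
Lemma lunit_unit_tens X : lunit (unit_ob ⊗ X) = idm unit_ob ⊠ lunit X.
Proof.
  apply: (split_mono_cancel (lunitK X)).
  by rewrite (lunit_natural HM).
Qed.

(** After whiskering by the unit object, [lunit_tens] and [lunit_unit_tens] turn the left side into
    that of the triangle. *)
Lemma lunit_runit_unit : lunit (@unit_ob M) = runit unit_ob.
Proof.
  apply: whisker_unit_r_inj.
  by rewrite -lunit_tens lunit_unit_tens (triangle HM).
Qed.

Lemma lunit_swap X : lunit X ∘ swap X unit_ob = runit X.
Proof.
  apply: whisker_unit_r_inj.
  (* Composing with the invertible [swap X unit_ob] brings in the second swap needed for the hexagon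
     at [X], [unit_ob], [unit_ob]. *)
  apply: (split_mono_cancel (swap_swap HM X unit_ob)).
  rewrite -whisker_r_comp -lunit_tens.
  rewrite !comp_assoc -(lunit_natural HM).
  crw (eq_sym (hexagon HM X unit_ob unit_ob)).
  by rewrite lunit_tens -(swap_natural HM) -comp_assoc (triangle HM).
Qed.

Lemma runit_swap X : runit X ∘ swap unit_ob X = lunit X.
Proof. by rewrite -lunit_swap -comp_assoc (swap_swap HM) comp_idr. Qed.

(* [slide] and [middle] are locked because rewriting with [comp_assoc] would
   otherwise unfold them. *)
Definition slide X Y Z : hom (X ⊗ (Y ⊗ Z)) (Y ⊗ (X ⊗ Z)) :=
  locked (assoc Y X Z ∘ (swap X Y ⊠ idm Z) ∘ assoc_inv X Y Z).

Definition middle W X Y Z : hom ((W ⊗ X) ⊗ (Y ⊗ Z)) ((W ⊗ Y) ⊗ (X ⊗ Z)) :=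
  locked (swap_middle W X Y Z).

Lemma middleE W X Y Z : middle W X Y Z = swap_middle W X Y Z.
Proof. by rewrite /middle -lock. Qed.

(** * The symmetry in front of a spectator *)

Lemma slide_assoc X Y Z :
  slide X Y Z ∘ assoc X Y Z = assoc Y X Z ∘ (swap X Y ⊠ idm Z).
Proof. by rewrite /slide -lock; crw (assocK X Y Z). Qed.

(** Like [slide_assoc], the form in which the definition gets used: composed with [assoc], no
    [assoc_inv] remains. *)
Lemma assoc_middle W X Y Z :
  assoc W Y (X ⊗ Z) ∘ middle W X Y Z
  = (idm W ⊠ slide X Y Z) ∘ assoc W X (Y ⊗ Z).
Proof.
  rewrite /middle -lock /swap_middle /slide -lock.
  by crw (assoc_invK W Y (X ⊗ Z)).
Qed.

Lemma slide_natural X X' Y Y' Z Z' (f : hom X X') (g : hom Y Y')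
    (h : hom Z Z') :
  slide X' Y' Z' ∘ (f ⊠ (g ⊠ h)) = (g ⊠ (f ⊠ h)) ∘ slide X Y Z.
Proof.
  apply: assoc_epi.
  crw (eq_sym (assoc_natural HM f g h)).
  crw (slide_assoc X' Y' Z').
  crw (slide_assoc X Y Z).
  rewrite -(assoc_natural HM) -!comp_assoc -!(tensm_comp HM).
  by rewrite (swap_natural HM) comp_idl comp_idr.
Qed.

Lemma slide_slide X Y Z : slide Y X Z ∘ slide X Y Z = idm _.
Proof.
  apply: assoc_epi.
  rewrite -comp_assoc slide_assoc comp_assoc slide_assoc -comp_assoc.
  by rewrite whisker_r_comp (swap_swap HM) (tensm_id HM) comp_idl comp_idr.
Qed.

(** The hexagon whiskered by the spectator [W]; the pentagons do the rebracketing. *)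
Lemma slide_tens_r X Y Z W :
  assoc Y Z (X ⊗ W) ∘ slide X (Y ⊗ Z) W
  = (idm Y ⊠ slide X Z W) ∘ slide X Y (Z ⊗ W) ∘ (idm X ⊠ assoc Y Z W).
Proof.
  apply: assoc_epi; apply: assoc_whisker_epi.
  crw (slide_assoc X (Y ⊗ Z) W).
  crw (pentagon HM Y Z X W).
  rewrite -!comp_assoc !whisker_r_comp !comp_assoc (hexagon HM) -!whisker_r_comp.
  crw (assoc_natural HM (idm Y) (swap X Z) (idm W)).
  rewrite whisker_l_comp -slide_assoc -whisker_l_comp.
  crw (eq_sym (pentagon HM Y X Z W)).
  crw (assoc_natural HM (swap X Y) (idm Z) (idm W)).
  crw (eq_sym (pentagon HM X Y Z W)).
  crw (slide_assoc X Y (Z ⊗ W)).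
  by rewrite (tensm_id HM).
Qed.

(** Obtained from [slide_tens_r] by inverting every slide with [slide_slide]. *)
Lemma slide_tens_l X Y Z W :
  (idm Z ⊠ assoc X Y W) ∘ slide (X ⊗ Y) Z W
  = slide X Z (Y ⊗ W) ∘ (idm X ⊠ slide Y Z W) ∘ assoc X Y (Z ⊗ W).
Proof.
  apply: (split_epi_cancel (slide_slide (X ⊗ Y) Z W)).
  crw (slide_slide Z (X ⊗ Y) W).
  crw (slide_tens_r Z X Y W).
  crw (whisker_l_comp X (slide Y Z W) (slide Z Y W)).
  rewrite slide_slide (tensm_id HM) comp_idr.
  by rewrite slide_slide comp_idl.
Qed.

(** Whiskering a slide by [W] merely enlarges its spectator from [Z] to [Z ⊗ W]. *)
Lemma slide_whisker X Y Z W :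
  (idm Y ⊠ assoc X Z W) ∘ assoc Y (X ⊗ Z) W ∘ (slide X Y Z ⊠ idm W)
  = slide X Y (Z ⊗ W) ∘ (idm X ⊠ assoc Y Z W) ∘ assoc X (Y ⊗ Z) W.
Proof.
  apply: assoc_whisker_epi.
  crw (whisker_r_comp W (slide X Y Z) (assoc X Y Z)).
  rewrite slide_assoc -whisker_r_comp.
  crw (eq_sym (pentagon HM Y X Z W)).
  crw (assoc_natural HM (swap X Y) (idm Z) (idm W)).
  crw (eq_sym (pentagon HM X Y Z W)).
  crw (slide_assoc X Y (Z ⊗ W)).
  by rewrite (tensm_id HM).
Qed.

Lemma swap_tens_r X Y Z :
  assoc Y Z X ∘ swap X (Y ⊗ Z) = (idm Y ⊠ swap X Z) ∘ slide X Y Z.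
Proof.
  apply: assoc_epi.
  by crw (hexagon HM X Y Z); crw (slide_assoc X Y Z).
Qed.

Lemma swap_tens_l X Y Z :
  swap (X ⊗ Y) Z = slide X Z Y ∘ (idm X ⊠ swap Y Z) ∘ assoc X Y Z.
Proof.
  apply: (split_epi_cancel (swap_swap HM (X ⊗ Y) Z)).
  crw (swap_tens_r Z X Y).
  crw (whisker_l_comp X (swap Y Z) (swap Z Y)).
  by rewrite !(swap_swap HM) (tensm_id HM) comp_idr slide_slide.
Qed.

Lemma lunit_slide X Y : lunit (X ⊗ Y) ∘ slide X unit_ob Y = idm X ⊠ lunit Y.
Proof.
  apply: assoc_epi.
  crw (slide_assoc X unit_ob Y).
  by rewrite lunit_tens whisker_r_comp lunit_swap (triangle HM).
Qed.

(** * Naturality and coherence of the middle interchange *)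

Lemma middle_natural W W' X X' Y Y' Z Z' (f : hom W W') (g : hom X X')
    (h : hom Y Y') (k : hom Z Z') :
  middle W' X' Y' Z' ∘ ((f ⊠ g) ⊠ (h ⊠ k))
  = ((f ⊠ h) ⊠ (g ⊠ k)) ∘ middle W X Y Z.
Proof.
  apply: assoc_mono.
  crw (assoc_middle W' X' Y' Z').
  crw (assoc_natural HM f g (h ⊠ k)).
  rewrite -(tensm_comp HM) comp_idl slide_natural.
  rewrite (assoc_natural HM) -[RHS]comp_assoc assoc_middle comp_assoc.
  by rewrite -(tensm_comp HM) comp_idr.
Qed.

(* The next three lemmas say that [middle] makes [⊗] a symmetric monoidal
   functor of two variables. *)
Lemma middle_assoc A B C D E F :
  assoc (A ⊗ B) (C ⊗ D) (E ⊗ F) ∘ (middle A C B D ⊠ idm (E ⊗ F))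
    ∘ middle (A ⊗ C) E (B ⊗ D) F
  = (idm (A ⊗ B) ⊠ middle C E D F) ∘ middle A (C ⊗ E) B (D ⊗ F)
    ∘ (assoc A C E ⊠ assoc B D F).
Proof.
  (* Postcompose with associators until the target is fully bracketed to the right. *)
  apply: assoc_mono.
  apply: (@split_mono_cancel _ _ _ _ (idm A ⊠ (idm B ⊠ assoc C D (E ⊗ F)))
           (idm A ⊠ (idm B ⊠ assoc_inv C D (E ⊗ F)))).
    by rewrite whisker_l_comp whisker_l_comp assocK !(tensm_id HM).
  (* Common normal form: rebracket the source to the right, let [E] cross [B] and then [D], and
     finally let [C] cross [B]. *)
  transitivity
    ((idm A ⊠ slide C B (D ⊗ (E ⊗ F)))
     ∘ (idm A ⊠ (idm C ⊠ (idm B ⊠ slide E D F)))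
     ∘ (idm A ⊠ (idm C ⊠ slide E B (D ⊗ F)))
     ∘ assoc A C (E ⊗ (B ⊗ (D ⊗ F))) ∘ assoc (A ⊗ C) E (B ⊗ (D ⊗ F))
     ∘ (idm ((A ⊗ C) ⊗ E) ⊠ assoc B D F)).
  - crw (pentagon HM A B (C ⊗ D) (E ⊗ F)).
    crw (whisker_r_comp (E ⊗ F) (assoc A B (C ⊗ D)) (middle A C B D)).
    rewrite assoc_middle -whisker_r_comp.
    crw (assoc_natural HM (idm A) (slide C B D) (idm (E ⊗ F))).
    rewrite !whisker_l_comp slide_whisker -!whisker_l_comp.
    crw (eq_sym (pentagon HM A C (B ⊗ D) (E ⊗ F))).
    crw (assoc_middle (A ⊗ C) E (B ⊗ D) F).
    rewrite -(tensm_id HM A C).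
    crw (assoc_natural HM (idm A) (idm C) (slide E (B ⊗ D) F)).
    crw (whisker_l_comp A (idm C ⊠ assoc B D (E ⊗ F)) (idm C ⊠ slide E (B ⊗ D) F)).
    rewrite (whisker_l_comp C (assoc B D (E ⊗ F)) (slide E (B ⊗ D) F)).
    (* [E] crosses [B ⊗ D] one factor at a time. *)
    rewrite slide_tens_r -!whisker_l_comp.
    crw (eq_sym (assoc_natural HM (idm A) (idm C) (idm E ⊠ assoc B D F))).
    rewrite (tensm_id HM A C).
    crw (eq_sym (assoc_natural HM (idm (A ⊗ C)) (idm E) (assoc B D F))).
    by rewrite (tensm_id HM).
  - rewrite -(tensm_id HM A B).
    crw (assoc_natural HM (idm A) (idm B) (middle C E D F)).
    crw (assoc_middle A (C ⊗ E) B (D ⊗ F)).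
    rewrite !(whisker_l_comp A) (whisker_l_comp B) assoc_middle.
    rewrite -(whisker_l_comp B) -(comp_assoc (idm B ⊠ _)) slide_tens_l.
    (* The crossing of [E] and [D] happens inside the spectator of the crossing of [C] and [B], so
       the two can be reordered. *)
    rewrite !comp_assoc -slide_natural -!whisker_l_comp.
    rewrite -(tensm_split_l (assoc A C E)).
    by crw (eq_sym (pentagon HM A C E (B ⊗ (D ⊗ F)))).
Qed.

Lemma middle_swap A B C D :
  swap (A ⊗ B) (C ⊗ D) ∘ middle A C B D
  = middle C A D B ∘ (swap A C ⊠ swap B D).
Proof.
  apply: assoc_mono.
  crw (swap_tens_r (A ⊗ B) C D).
  rewrite swap_tens_l -!whisker_l_comp.
  crw (slide_tens_l A B C D).
  crw (assoc_middle A C B D).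
  (* The crossing of [C] and [B] made by [middle] is undone by one of those making up the large
     swap. *)
  crw (whisker_l_comp A (slide B C D) (slide C B D)).
  rewrite slide_slide (tensm_id HM) comp_idr.
  crw (eq_sym (slide_natural (idm A) (idm C) (swap B D))).
  crw (assoc_middle C A D B).
  crw (eq_sym (assoc_natural HM (idm A) (idm C) (swap B D))).
  rewrite (tensm_id HM).
  crw (slide_assoc A C (D ⊗ B)).
  by crw (tensm_split_l (swap A C) (swap B D)).
Qed.

Lemma middle_lunit X Y :
  lunit (X ⊗ Y) ∘ (lunit unit_ob ⊠ idm (X ⊗ Y))
    ∘ middle unit_ob X unit_ob Y
  = lunit X ⊠ lunit Y.
Proof.
  (* Trading [lunit unit_ob] for [runit unit_ob] lets the triangle supply the associator that
     [assoc_middle] needs. *)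
  rewrite lunit_runit_unit -(triangle HM) comp_assoc.
  crw (assoc_middle unit_ob X unit_ob Y).
  crw (whisker_l_comp unit_ob (lunit (X ⊗ Y)) (slide X unit_ob Y)).
  rewrite lunit_slide (lunit_natural HM).
  by crw (lunit_tens X (unit_ob ⊗ Y)); rewrite tensm_split_r.
Qed.

(** * Comonoid structure on the unit and on tensor products *)

Lemma lunit_unit_assoc :
  lunit unit_ob ∘ (idm unit_ob ⊠ lunit unit_ob)
    ∘ assoc unit_ob unit_ob (@unit_ob M)
  = lunit unit_ob ∘ (lunit unit_ob ⊠ idm unit_ob).
Proof. by rewrite -comp_assoc (triangle HM) -lunit_runit_unit. Qed.

(** Together with [lunit_unit_assoc]: [lunit unit_ob] is an associative, commutative multiplication
    on the unit object. *)
Lemma lunit_unit_swap :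
  lunit unit_ob ∘ swap unit_ob (@unit_ob M) = lunit unit_ob.
Proof. by rewrite lunit_swap lunit_runit_unit. Qed.

(** Cocommutativity and naturality of [swap] turn the left counit law into the right one. *)
Lemma comonoid_of_counital_l X (mu : hom X (X ⊗ X)) (e : hom X unit_ob) :
  assoc X X X ∘ (mu ⊠ idm X) ∘ mu = (idm X ⊠ mu) ∘ mu ->
  lunit X ∘ (e ⊠ idm X) ∘ mu = idm X ->
  swap X X ∘ mu = mu ->
  is_commutative_comonoid mu e.
Proof.
  move=> coass counit cocomm; split=> //.
  rewrite -{1}cocomm.
  crw (eq_sym (swap_natural HM e (idm X))).
  by crw (runit_swap X).
Qed.

Lemma tens_is_commutative_comonoid (X Y : comonoid_data M) :
  is_commutative_comonoid (comult X) (counit X) ->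
  is_commutative_comonoid (comult Y) (counit Y) ->
  is_commutative_comonoid (comult (tens_comonoid_data X Y))
                          (counit (tens_comonoid_data X Y)).
Proof.
  case: X => X mu e; case: Y => Y nu d /= lawX lawY.
  rewrite -middleE; apply: comonoid_of_counital_l.
  - rewrite -whisker_r_comp -whisker_l_comp -!(tensm_id HM X Y).
    crw (eq_sym (middle_natural mu (idm X) nu (idm Y))).
    rewrite (tensm_id HM X Y).
    crw (middle_assoc X Y X Y X Y).
    rewrite -!(tensm_id HM X Y).
    crw (eq_sym (middle_natural (idm X) mu (idm Y) nu)).
    (* The same interchanges now come last on both sides; what precedes them is regrouped into a
       tensor of an [X]-composite and a [Y]-composite. *)
    rewrite -!(comp_assoc _ _ (mu ⊠ nu)) -!(comp_assoc _ (_ ⊠ _) (_ ⊠ _ ∘ _)).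
    rewrite -!(tensm_comp HM) !comp_assoc.
    by rewrite (coassociative lawX) (coassociative lawY).
  - rewrite -whisker_r_comp -!(tensm_id HM X Y).
    crw (eq_sym (middle_natural e (idm X) d (idm Y))).
    rewrite (tensm_id HM X Y).
    crw (middle_lunit X Y).
    rewrite -!(tensm_comp HM).
    by rewrite (counital_l lawX) (counital_l lawY) (tensm_id HM).
  - crw (middle_swap X Y X Y).
    rewrite -comp_assoc -(tensm_comp HM).
    by rewrite (cocommutative lawX) (cocommutative lawY).
Qed.

Lemma unit_is_commutative_comonoid :
  is_commutative_comonoid (comult (@unit_comonoid_data M))
                          (counit (@unit_comonoid_data M)).
Proof.
  apply: comonoid_of_counital_l => /=.
  (* Composing with unitors reduces coassociativity of [lunit_inv unit_ob] to associativity of its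
     inverse. *)
  - apply: (@split_mono_cancel _ _ _ _ (idm unit_ob ⊠ lunit unit_ob)
              (idm unit_ob ⊠ lunit_inv unit_ob)).
      by rewrite whisker_l_comp lunitK (tensm_id HM).
    apply: (split_mono_cancel (lunitK unit_ob)).
    crw lunit_unit_assoc.
    crw (whisker_r_comp unit_ob (lunit unit_ob) (lunit_inv unit_ob)).
    crw (whisker_l_comp unit_ob (lunit unit_ob) (lunit_inv unit_ob)).
    by rewrite lunit_invK.
  - by rewrite (tensm_id HM) comp_idr lunit_invK.
  - apply: (split_mono_cancel (lunitK unit_ob)).
    by crw lunit_unit_swap.
Qed.

(** * Counit preservation of the structure morphisms *)

Lemma counit_preserving_inv (X Y : comonoid_data M)
    (f : hom (carrier X) (carrier Y)) (g : hom (carrier Y) (carrier X)) :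
  f ∘ g = idm _ -> counit_preserving f -> counit_preserving g.
Proof.
  rewrite /counit_preserving => fg <-.
  by rewrite -comp_assoc fg comp_idr.
Qed.

Lemma assoc_counit_preserving (X Y Z : comonoid_data M) :
  @counit_preserving M
    (tens_comonoid_data (tens_comonoid_data X Y) Z)
    (tens_comonoid_data X (tens_comonoid_data Y Z))
    (assoc (carrier X) (carrier Y) (carrier Z)).
Proof.
  case: X Y Z => [X ? e] [Y ? d] [Z ? c]; rewrite /counit_preserving /=.
  (* The inserted identities let [tensm_comp] separate the unitors from the counits. *)
  rewrite -[e in LHS]comp_idl -[c in RHS]comp_idl !(tensm_comp HM).
  crw (eq_sym (assoc_natural HM e d c)).
  by crw lunit_unit_assoc.
Qed.

Lemma lunit_counit_preserving (X : comonoid_data M) :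
  @counit_preserving M (tens_comonoid_data unit_comonoid_data X) X
    (lunit (carrier X)).
Proof. by rewrite /counit_preserving -(lunit_natural HM). Qed.

Lemma runit_counit_preserving (X : comonoid_data M) :
  @counit_preserving M (tens_comonoid_data X unit_comonoid_data) X
    (runit (carrier X)).
Proof.
  by rewrite /counit_preserving -(runit_natural HM) -lunit_runit_unit.
Qed.

Lemma comonoids_are_closed : comonoids_closed M.
Proof.
  split.
  - move=> X Y.
    exact: tens_is_commutative_comonoid (comonoid_laws X) (comonoid_laws Y).
  - exact: unit_is_commutative_comonoid.
  - move=> X X' Y Y' [f pf] [g pg]; rewrite /counit_preserving /=.
    by rewrite -comp_assoc -(tensm_comp HM) pf pg.
  - by move=> X Y Z; apply: assoc_counit_preserving.
  - move=> X Y Z.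
    apply: counit_preserving_inv (assoc_counit_preserving X Y Z).
    exact: assoc_invK.
  - by move=> X; apply: lunit_counit_preserving.
  - move=> X.
    apply: counit_preserving_inv (lunit_counit_preserving X).
    exact: lunit_invK.
  - by move=> X; apply: runit_counit_preserving.
  - move=> X.
    apply: counit_preserving_inv (runit_counit_preserving X).
    exact: runit_invK.
  - move=> X Y; rewrite /counit_preserving /=.
    by crw (eq_sym (swap_natural HM (counit X) (counit Y))); rewrite lunit_unit_swap.
  (* For the comultiplication: naturality of [lunit] extracts one counit, and the counit law absorbs
     the other. *)
  - move=> X; rewrite /counit_preserving /= -tensm_split_r.
    crw (lunit_natural HM (counit X)).
    rewrite -!comp_assoc (comp_assoc (lunit _)).
    by rewrite (counital_l (comonoid_laws X)) comp_idr.
  - by move=> X; rewrite /counit_preserving /= comp_idl.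
Qed.

End SymmetricMonoidal.

Theorem proposition9p1 :
  forall D : symmetric_monoidal_category,
    exists H : comonoids_closed D, is_markov_category (comonoid_markov H).
Proof.
  move=> D; have HD := smc_laws D.
  exists (comonoids_are_closed HD); split.
  (* Equality of comonoid morphisms is equality in [D], so each law is inherited from [D]. *)
  - split=> *; try split; apply: comonoid_hom_eq.
    + exact: (tensm_id HD).
    + exact: (tensm_comp HD).
    + exact: assocK.
    + exact: assoc_invK.
    + exact: lunitK.
    + exact: lunit_invK.
    + exact: proj1 (runit_iso HD _).
    + exact: runit_invK.
    + exact: (assoc_natural HD).
    + exact: (lunit_natural HD).
    + exact: (runit_natural HD).
    + exact: (swap_natural HD).
    + exact: (pentagon HD).
    + exact: (triangle HD).
    + exact: (hexagon HD).
    + exact: (swap_swap HD).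
  - move=> X; have lawX := comonoid_laws X.
    split; apply: comonoid_hom_eq.
    + exact: coassociative lawX.
    + exact: counital_l lawX.
    + exact: counital_r lawX.
    + exact: cocommutative lawX.
  (* Compatibility of [del], and next of [copy], with tensors is the definition of the tensor
     comonoid. *)
  - by move=> X Y; apply: comonoid_hom_eq.
  - by move=> X Y; apply: comonoid_hom_eq.
  (* Naturality of [del] is precisely counit preservation, [pf]. *)
  - by move=> X Y [f pf]; apply: comonoid_hom_eq.
Qed.
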